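(* Let $M,m$ be coprime positive integers, $m_2$ an integer with $0\le m_2\le m-1$, $\heartsuit\in\{\mathrm I,\mathrm{II},\mathrm{III},\mathrm{IV}\}$, and $(k_1,k_2)$ integers in the range attached to $\heartsuit$ (see context). The numerators of the N=4 modules $\ddot H(\Lambda^{(M)[K(m),m_2](\heartsuit)}_{k_1,k_2})$ are as follows. 1) $\big[\overset{N=4}{R}{}^{(+)}\cdot\mathrm{ch}^{(+)}_{\ddot H(\Lambda^{(M)[K(m),m_2](\heartsuit)}_{k_1,k_2})}\big](\tau,z)$ equals (i) for $\heartsuit=\mathrm I$: $(-1)^{m_2+1}\Psi^{[M,m,m_2+1;\frac12]}_{k_1+\frac12,\,-(k_1+k_2+\frac12);\,\frac12}(\tau,z,z,0)$; (ii) for $\heartsuit=\mathrm{II}$: $(-1)^{m_2+1}\Psi^{[M,m,m_2+1;\frac12]}_{k_1-\frac12,\,-(k_1+k_2-\frac12);\,\frac12}(\tau,-z,-z,0)$; (iii) for $\heartsuit=\mathrm{III}$: $(-1)^{m_2+1}\Psi^{[M,m,m_2+1;\frac12]}_{k_1+\frac12,\,-(k_1+k_2+\frac12);\,\frac12}(\tau,-z,-z,0)$; (iv) for $\heartsuit=\mathrm{IV}$: $(-1)^{m_2+1}\Psi^{[M,m,m_2+1;\frac12]}_{k_1-\frac12,\,-(k_1+k_2-\frac12);\,\frac12}(\tau,z,z,0)$. 2) $\big[\overset{N=4}{R}{}^{(-)}\cdot\mathrm{ch}^{(-)}_{\ddot H(\Lambda^{(M)[K(m),m_2](\heartsuit)}_{k_1,k_2})}\big](\tau,z)$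 equals (i) for $\heartsuit=\mathrm I$: $\Psi^{[M,m,m_2+1;0]}_{k_1+\frac12,\,-(k_1+k_2+\frac12);\,\frac12}(\tau,z,z,0)$; (ii) for $\heartsuit=\mathrm{II}$: $\Psi^{[M,m,m_2+1;0]}_{k_1-\frac12,\,-(k_1+k_2-\frac12);\,\frac12}(\tau,-z,-z,0)$; (iii) for $\heartsuit=\mathrm{III}$: $\Psi^{[M,m,m_2+1;0]}_{k_1+\frac12,\,-(k_1+k_2+\frac12);\,\frac12}(\tau,-z,-z,0)$; (iv) for $\heartsuit=\mathrm{IV}$: $\Psi^{[M,m,m_2+1;0]}_{k_1-\frac12,\,-(k_1+k_2-\frac12);\,\frac12}(\tau,z,z,0)$.
   Context: Functions ($\mathrm{Im}\,\tau>0$, $q=e^{2\pi i\tau}$; $m\in\frac12\mathbf Z_{>0}$, $s\in\frac12\mathbf Z$): $$\Phi^{[m,s]}(\tau,z_1,z_2,t)=e^{-2\pi imt}\sum_{j\in\mathbf Z}\Big(\frac{e^{2\pi imj(z_1+z_2)+2\pi isz_1}q^{mj^2+sj}}{1-e^{2\pi iz_1}q^j}-\frac{e^{-2\pi imj(z_1+z_2)-2\pi isz_2}q^{mj^2+sj}}{1-e^{-2\pi iz_2}q^j}\Big),$$ $$\Phi^{(A(1|1))[m,s]}(\tau,z_1,z_2,t)=e^{-2\pi imt}\sum_{j\in\mathbf Z}\Big(\frac{e^{2\pi imj(z_1+z_2)+2\pi isz_1}q^{mj^2+sj}}{(1-e^{2\pi iz_1}q^j)^2}-\frac{e^{-2\pi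 imj(z_1+z_2)-2\pi isz_2}q^{mj^2+sj}}{(1-e^{-2\pi iz_2}q^j)^2}\Big),$$ $$\Psi^{[M,m,s;\varepsilon]}_{j,k;\varepsilon'}(\tau,z_1,z_2,t)=q^{\frac mMjk}e^{\frac{2\pi im}M(kz_1+jz_2)}\Phi^{[m,s]}\big(M\tau,z_1+j\tau+\varepsilon,z_2+k\tau-\varepsilon,\tfrac tM\big),\quad \varepsilon,\varepsilon'\in\{0,\tfrac12\},\ j,k\in\varepsilon'+\mathbf Z.$$ Weights: $\widehat A(1,1)$ is the affine Lie superalgebra of $sl(2|2)/\mathbf CI$ with simple roots $\alpha_0,\dots,\alpha_3$ ($\alpha_1,\alpha_3$ odd), $\delta=\sum\alpha_i$, $\theta=\alpha_1+\alpha_2+\alpha_3$. $\Lambda^{(M)[K(m),m_2](\heartsuit)}_{k_1,k_2}$ ($0\le m_2\le m$) is the principal admissible weight of level $-\frac mM$ with integrable part $-m\Lambda_0-\frac{m_2}2(\alpha_1+\alpha_3)$ and simple subset (with $k_3=k_1$) $\Pi^{(\mathrm I)}=\{k_i\delta+\alpha_i\}_{i=0}^3$, $M=\sum k_i+1$; $\Pi^{(\mathrm{II})}=\{k_i\delta-\alpha_i\}_{i=0}^3$, $M=\sum k_i-1$; $\Pi^{(\mathrm{III})}=\{k_0\delta+\alpha_0,k_1\delta+\alpha_1+\alpha_2,k_2\delta-\alpha_2,k_3\delta+\alpha_2+\alpha_3\}$, $M=\sum k_i+1$; $\Pi^{(\mathrm{IV})}=\{k_0\delta-\alpha_0,k_1\delta-\alpha_1-\alpha_2,k_2\delta+\alpha_2,k_3\delta-\alpha_2-\alpha_3\}$,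 $M=\sum k_i-1$. Ranges: I: $k_1,k_2\ge0$, $2k_1+k_2\le M-1$; II: $k_1,k_2\ge1$, $2k_1+k_2\le M$; III: $k_1\ge0,k_2\ge1$, $2k_1+k_2\le M-1$; IV: $k_1\ge1,k_2\ge0$, $2k_1+k_2\le M$. Characters of $\widehat A(1,1)$-modules: for $\lambda=\Lambda^{(M)[K(m),m_2](\heartsuit)}_{k_1,k_2}$ the numerator of $L(\lambda)$ ($\widehat R^{(\pm)}$ being the denominator and super-denominator of $\widehat A(1,1)$) in the coordinates $(\tau,z_1,z_2,t)=2\pi i(-\tau\Lambda_0+\frac{z_2-z_1}2(\alpha_1+\alpha_3)-z_1\alpha_2+t\delta)$ is $$[\widehat R^{(\pm)}\mathrm{ch}^{(\pm)}_{L(\lambda)}](\tau,z_1,z_2,t)=\sigma_\pm\,\Phi^{(A(1|1))[m,m_2+1]}(M\tau,\zeta_1+a_\pm,\zeta_2+a_\pm,T),$$ with $(\sigma_+,a_+)=((-1)^{m_2+1},\frac12)$, $(\sigma_-,a_-)=(1,0)$ and $(\zeta_1,\zeta_2,MT)$ equal to I: $(z_1+k_1\tau,\ z_2-(k_1+k_2)\tau,\ t+(k_1+k_2)z_1-k_1z_2+k_1(k_1+k_2)\tau)$; II: $(-z_1+k_1\tau,\ -z_2-(k_1+k_2)\tau,\ t-(k_1+k_2)z_1+k_1z_2+k_1(k_1+k_2)\tau)$; III: $(-z_2+k_1\tau,\ -z_1-(k_1+k_2)\tau,\ t+k_1z_1-(k_1+k_2)z_2+k_1(k_1+k_2)\tau)$;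 IV: $(z_2+k_1\tau,\ z_1-(k_1+k_2)\tau,\ t-k_1z_1+(k_1+k_2)z_2+k_1(k_1+k_2)\tau)$. Reduction: $H(\lambda)$ is the N=4 superconformal module obtained from $L(\lambda)$ by quantum Hamiltonian reduction with $x=\frac12\theta$, $f=e_{-\theta}$, $J_0=-\alpha_2$. With $\overset{N=4}{R}{}^{(\pm)}$ the denominator and super-denominator of the N=4 superconformal algebra, its numerators are $[\overset{N=4}{R}{}^{(\pm)}\mathrm{ch}^{(\pm)}_{H(\lambda)}](\tau,z)=[\widehat R^{(\pm)}\mathrm{ch}^{(\pm)}_{L(\lambda)}](\tau,z+\frac\tau2,z-\frac\tau2,\frac\tau4)$. For $m_2\le m-1$, $\ddot H(\Lambda^{(M)[K(m),m_2](\heartsuit)}_{k_1,k_2}):=H(\Lambda^{(M)[K(m),m_2](\heartsuit)}_{k_1,k_2})\oplus H(\Lambda^{(M)[K(m),m_2+1](\heartsuit)}_{k_1,k_2})$, the highest weight vectors of the two summands having opposite parity, so that $\mathrm{ch}^{(\pm)}_{\ddot H(\Lambda^{(M)[K(m),m_2](\heartsuit)}_{k_1,k_2})}=\mathrm{ch}^{(\pm)}_{H(\Lambda^{(M)[K(m),m_2](\heartsuit)}_{k_1,k_2})}\pm\mathrm{ch}^{(\pm)}_{H(\Lambda^{(M)[K(m),m_2+1](\heartsuit)}_{k_1,k_2})}$. *)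

(* Defs.v *)
From Stdlib Require Import Reals ZArith List.
From Coquelicot Require Import Coquelicot.
Import ListNotations.
Open Scope R_scope.

(** * Bilateral sums and the functions [Phi], [PhiA11], [Psi] *)

(** e^{2 pi i z}.  With [tau] in the upper half plane, q^x is [e2pi (x * tau)]. *)
Definition e2pi (z : C) : C :=
  (exp (- (2 * PI * Im z)) * cos (2 * PI * Re z),
   exp (- (2 * PI * Im z)) * sin (2 * PI * Re z)).

Definition CSeries (a : nat -> C) : C :=
  (Series (fun n => Re (a n)), Series (fun n => Im (a n))).

Definition Zsum (a : Z -> C) : C :=
  (CSeries (fun n => a (Z.of_nat n)) +
   CSeries (fun n => a (- Z.of_nat (S n))%Z))%C.

(** The parameters [m], [s] are half-integers in the applications, whence their
    type [R].  Division by zero being total, the value given at a pole is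
    meaningless. *)
Definition Phi (m s : R) (tau z1 z2 t : C) : C :=
  (e2pi (- (m * t)) *
   Zsum (fun n =>
     let j := IZR n in
     e2pi (m * j * (z1 + z2) + s * z1) * e2pi ((m * j ^ 2 + s * j)%R * tau)
       / (1 - e2pi z1 * e2pi (j * tau))
     - e2pi (- (m * j * (z1 + z2)) - s * z2) * e2pi ((m * j ^ 2 + s * j)%R * tau)
       / (1 - e2pi (- z2) * e2pi (j * tau))))%C.

Definition PhiA11 (m s : R) (tau z1 z2 t : C) : C :=
  (e2pi (- (m * t)) *
   Zsum (fun n =>
     let j := IZR n in
     e2pi (m * j * (z1 + z2) + s * z1) * e2pi ((m * j ^ 2 + s * j)%R * tau)
       / ((1 - e2pi z1 * e2pi (j * tau)) * (1 - e2pi z1 * e2pi (j * tau)))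
     - e2pi (- (m * j * (z1 + z2)) - s * z2) * e2pi ((m * j ^ 2 + s * j)%R * tau)
       / ((1 - e2pi (- z2) * e2pi (j * tau)) * (1 - e2pi (- z2) * e2pi (j * tau)))))%C.

(** [Psi M m s eps j k eps'] has [j], [k] in eps' + Z; the label [eps'] only
    records this coset and does not enter the formula. *)
Definition Psi (M m s eps j k eps' : R) (tau z1 z2 t : C) : C :=
  (e2pi ((m / M * j * k)%R * tau) * e2pi ((m / M)%R * (k * z1 + j * z2)) *
   Phi m s (M * tau) (z1 + j * tau + eps) (z2 + k * tau - eps) (t / M))%C.

(** * Principal admissible weights of the affine superalgebra A(1,1)^ *)

(** Coordinates of a root with respect to alpha_0, ..., alpha_3. *)
Record root := Root { rc0 : Z; rc1 : Z; rc2 : Z; rc3 : Z }.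

Definition radd (a b : root) : root :=
  Root (rc0 a + rc0 b) (rc1 a + rc1 b) (rc2 a + rc2 b) (rc3 a + rc3 b).
Definition rscale (n : Z) (a : root) : root :=
  Root (n * rc0 a) (n * rc1 a) (n * rc2 a) (n * rc3 a).
Definition ropp (a : root) : root := rscale (-1) a.

Definition alpha0 := Root 1 0 0 0.
Definition alpha1 := Root 0 1 0 0.
Definition alpha2 := Root 0 0 1 0.
Definition alpha3 := Root 0 0 0 1.
Definition delta := radd (radd alpha0 alpha1) (radd alpha2 alpha3).

(** The weight c Lambda_0 + c_0 alpha_0 + ... + c_3 alpha_3. *)
Record aff_weight :=
  AffWeight { wcL : R; wc0 : R; wc1 : R; wc2 : R; wc3 : R }.

(** A principal admissible weight is given by its level, its integrable part
    and its simple subset. *)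
Record pa_weight := PAWeight {
  pa_level : R;
  pa_integrable : aff_weight;
  pa_simple : list root }.

Inductive heart := heartI | heartII | heartIII | heartIV.

Definition simple_subset (h : heart) (k0 k1 k2 k3 : Z) : list root :=
  let sh k a := radd (rscale k delta) a in
  match h with
  | heartI => [sh k0 alpha0; sh k1 alpha1; sh k2 alpha2; sh k3 alpha3]
  | heartII => [sh k0 (ropp alpha0); sh k1 (ropp alpha1);
                sh k2 (ropp alpha2); sh k3 (ropp alpha3)]
  | heartIII => [sh k0 alpha0; sh k1 (radd alpha1 alpha2);
                 sh k2 (ropp alpha2); sh k3 (radd alpha2 alpha3)]
  | heartIV => [sh k0 (ropp alpha0); sh k1 (ropp (radd alpha1 alpha2));
                sh k2 alpha2; sh k3 (ropp (radd alpha2 alpha3))]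
  end.

(** [k0] is determined by M = k0 + k1 + k2 + k3 + 1 (types I, III), resp.
    M = k0 + k1 + k2 + k3 - 1 (types II, IV), where k3 = k1. *)
Definition k0_of (h : heart) (M k1 k2 : Z) : Z :=
  match h with
  | heartI | heartIII => M - 1 - 2 * k1 - k2
  | heartII | heartIV => M + 1 - 2 * k1 - k2
  end.

Definition k_range (h : heart) (M k1 k2 : Z) : Prop :=
  match h with
  | heartI => (0 <= k1 /\ 0 <= k2 /\ 2 * k1 + k2 <= M - 1)%Z
  | heartII => (1 <= k1 /\ 1 <= k2 /\ 2 * k1 + k2 <= M)%Z
  | heartIII => (0 <= k1 /\ 1 <= k2 /\ 2 * k1 + k2 <= M - 1)%Z
  | heartIV => (1 <= k1 /\ 0 <= k2 /\ 2 * k1 + k2 <= M)%Z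
  end.

Definition Lambda (M m m2 : Z) (h : heart) (k1 k2 : Z) : pa_weight :=
  PAWeight (- (IZR m / IZR M))
    (AffWeight (- IZR m) 0 (- (IZR m2 / 2)) 0 (- (IZR m2 / 2)))
    (simple_subset h (k0_of h M k1 k2) k1 k2 k1).

Definition admissible (M m m2 : Z) (h : heart) (k1 k2 : Z) : Prop :=
  (0 < M)%Z /\ (0 < m)%Z /\ Z.gcd M m = 1%Z /\
  (0 <= m2 <= m)%Z /\ k_range h M k1 k2.

(** * Numerators of the modules L(lambda) *)

(** [Plus] for characters, [Minus] for supercharacters. *)
Inductive sgn := Plus | Minus.

Definition sigma (e : sgn) (m2 : Z) : R :=
  match e with Plus => powerRZ (-1) (m2 + 1) | Minus => 1 end.
Definition ashift (e : sgn) : R :=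
  match e with Plus => 1 / 2 | Minus => 0 end.

Definition zeta1 (h : heart) (k1 k2 : R) (tau z1 z2 : C) : C :=
  match h with
  | heartI => z1 + k1 * tau
  | heartII => - z1 + k1 * tau
  | heartIII => - z2 + k1 * tau
  | heartIV => z2 + k1 * tau
  end%C.

Definition zeta2 (h : heart) (k1 k2 : R) (tau z1 z2 : C) : C :=
  match h with
  | heartI => z2 - (k1 + k2) * tau
  | heartII => - z2 - (k1 + k2) * tau
  | heartIII => - z1 - (k1 + k2) * tau
  | heartIV => z1 - (k1 + k2) * tau
  end%C.

Definition MT (h : heart) (k1 k2 : R) (tau z1 z2 t : C) : C :=
  match h with
  | heartI => t + (k1 + k2) * z1 - k1 * z2 + k1 * (k1 + k2) * tau
  | heartII => t - (k1 + k2) * z1 + k1 * z2 + k1 * (k1 + k2) * tau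
  | heartIII => t + k1 * z1 - (k1 + k2) * z2 + k1 * (k1 + k2) * tau
  | heartIV => t - k1 * z1 + (k1 + k2) * z2 + k1 * (k1 + k2) * tau
  end%C.

(** [numL e lambda tau z1 z2 t] is the numerator [R^(e) ch^(e)_{L(lambda)}] of the
    affine superalgebra module L(lambda), as a meromorphic function of the
    coordinates.  It is not split into the two factors, since the reduction
    evaluates it where the affine denominator vanishes. *)
Definition numerators_L
    (numL : sgn -> pa_weight -> C -> C -> C -> C -> C) : Prop :=
  forall (e : sgn) (M m m2 : Z) (h : heart) (k1 k2 : Z) (tau z1 z2 t : C),
    admissible M m m2 h k1 k2 -> 0 < Im tau ->
    numL e (Lambda M m m2 h k1 k2) tau z1 z2 t =
    (sigma e m2 *
     PhiA11 (IZR m) (IZR m2 + 1)%R (IZR M * tau)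
       (zeta1 h (IZR k1) (IZR k2) tau z1 z2 + ashift e)
       (zeta2 h (IZR k1) (IZR k2) tau z1 z2 + ashift e)
       (MT h (IZR k1) (IZR k2) tau z1 z2 t / IZR M))%C.

(** * N=4 superconformal modules *)

(** A module is represented by the traces, as functions of (tau, z), of
    q^{L_0 - c/24} e^{2 pi i z J_0} on its even and on its odd part. *)
Record N4module := N4Module {
  tr_even : C -> C -> C;
  tr_odd : C -> C -> C }.

Definition dsum (V W : N4module) : N4module :=
  N4Module (fun tau z => tr_even V tau z + tr_even W tau z)%C
           (fun tau z => tr_odd V tau z + tr_odd W tau z)%C.

(** Parity reversal. *)
Definition parity_rev (V : N4module) : N4module :=
  N4Module (tr_odd V) (tr_even V).

Definition ch (e : sgn) (V : N4module) (tau z : C) : C :=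
  match e with
  | Plus => tr_even V tau z + tr_odd V tau z
  | Minus => tr_even V tau z - tr_odd V tau z
  end%C.

(** [R4 e] is the N=4 denominator, resp. super-denominator, and [H lambda] the
    quantum Hamiltonian reduction of L(lambda).  [dom] is a set of points
    (tau, z) at which these denominators and the characters of all the modules
    [H lambda] are finite, so that their pointwise product is meaningful. *)
Definition numerators_H
    (numL : sgn -> pa_weight -> C -> C -> C -> C -> C)
    (R4 : sgn -> C -> C -> C) (H : pa_weight -> N4module)
    (dom : C -> C -> Prop) : Prop :=
  forall (e : sgn) (M m m2 : Z) (h : heart) (k1 k2 : Z) (tau z : C),
    admissible M m m2 h k1 k2 -> 0 < Im tau -> dom tau z ->
    (R4 e tau z * ch e (H (Lambda M m m2 h k1 k2)) tau z)%C =
    numL e (Lambda M m m2 h k1 k2) tau (z + tau / 2)%C (z - tau / 2)%C (tau / 4)%C.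

(** The two highest weight vectors are given opposite parities. *)
Definition ddotH (H : pa_weight -> N4module)
    (M m m2 : Z) (h : heart) (k1 k2 : Z) : N4module :=
  dsum (H (Lambda M m m2 h k1 k2))
       (parity_rev (H (Lambda M m (m2 + 1) h k1 k2))).

(* Main.v *)
(** The reduction to N=4 evaluates both numerators at the same point, so the
    claim rests on the identity Phi^(A(1|1))[m,s] - Phi^(A(1|1))[m,s+1] = Phi[m,s]:
    raising s by one multiplies the j-th numerator by x = e(z_1) q^j, resp.
    x = e(-z_2) q^j, and a/(1-x)^2 - a x/(1-x)^2 = a/(1-x).  The series may be
    subtracted termwise since q^(m j^2) makes them absolutely convergent.  The
    rest is a comparison of arguments; the shift -1/2 in the second argument of
    Psi, against +1/2 in the numerator, is absorbed by the invariance of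
    Phi[m,s] under z_2 -> z_2 + 1 for integral m and s. *)
Require Import Defs.
From Stdlib Require Import Reals ZArith Lra Lia.
From Coquelicot Require Import Coquelicot.
Open Scope R_scope.

(** * The exponential [e2pi]: additivity, integer periods, modulus *)

Lemma C_eq (x y : C) : Re x = Re y -> Im x = Im y -> x = y.
Proof. destruct x, y; simpl; congruence. Qed.

Lemma e2pi_plus (x y : C) : e2pi (x + y) = (e2pi x * e2pi y)%C.
Proof.
destruct x as [a b], y as [c d].
unfold e2pi, Cmult, Cplus; simpl.
replace (- (2 * PI * (b + d))) with (- (2 * PI * b) + - (2 * PI * d)) by ring.
rewrite !Rmult_plus_distr_l, cos_plus, sin_plus, exp_plus.
apply C_eq; simpl; ring.
Qed.

Lemma e2pi_0 : e2pi 0 = 1.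
Proof.
unfold e2pi; simpl.
rewrite !Rmult_0_r, Ropp_0, exp_0, cos_0, sin_0.
apply C_eq; simpl; ring.
Qed.

Lemma e2pi_1 : e2pi 1 = 1.
Proof.
unfold e2pi; simpl.
rewrite !Rmult_0_r, Ropp_0, exp_0, Rmult_1_r, cos_2PI, sin_2PI.
apply C_eq; simpl; ring.
Qed.

Lemma e2pi_IZR (n : Z) : e2pi (IZR n) = 1.
Proof.
induction n as [|n IH|n IH] using Z.peano_ind.
- exact e2pi_0.
- unfold Z.succ; rewrite plus_IZR, RtoC_plus, e2pi_plus, IH, e2pi_1; ring.
- assert (E : e2pi (IZR (Z.pred n) + 1)%C = e2pi (IZR n)).
  { f_equal; rewrite <- RtoC_plus, <- plus_IZR; do 2 f_equal; lia. }
  rewrite e2pi_plus, e2pi_1, IH, Cmult_1_r in E; exact E.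
Qed.

(** The shift is a hypothesis rather than part of the left side, so that a rewrite leaves a ring
    identity between the two exponents. *)
Lemma e2pi_add_IZR (x y : C) (n : Z) : y = (x + IZR n)%C -> e2pi y = e2pi x.
Proof. intros ->; rewrite e2pi_plus, e2pi_IZR; ring. Qed.

Lemma Cmod_e2pi (z : C) : Cmod (e2pi z) = exp (- (2 * PI * Im z)).
Proof.
unfold e2pi, Cmod; simpl.
set (r := exp _); set (x := 2 * PI * Re z).
replace (_ + _) with (r² * (cos x * cos x + sin x * sin x)) by (unfold Rsqr; ring).
rewrite Rplus_comm; change (cos x * cos x) with (cos x)².
change (sin x * sin x) with (sin x)².
rewrite sin2_cos2, Rmult_1_r.
apply sqrt_Rsqr; left; apply exp_pos.
Qed.

(** * Termwise subtraction of rapidly decaying bilateral sums *)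

(** Only large |j| are constrained, so that finitely many terms, among them those at a pole, may
    take any value. *)
Definition exp_decay (a : Z -> C) : Prop :=
  exists N K : R, forall j : Z, N <= Rabs (IZR j) ->
    Cmod (a j) <= K * exp (- Rabs (IZR j)).

Lemma exp_decay_minus (a b : Z -> C) :
  exp_decay a -> exp_decay b -> exp_decay (fun j => (a j - b j)%C).
Proof.
intros (N & K & Ha) (N' & K' & Hb).
exists (Rmax N N'), (K + K'); intros j Hj.
unfold Cminus; eapply Rle_trans; [apply Cmod_triangle|].
rewrite Cmod_opp, Rmult_plus_distr_r.
apply Rplus_le_compat; [apply Ha | apply Hb]; eapply Rle_trans; eauto.
- apply Rmax_l.
- apply Rmax_r.
Qed.

Lemma ex_series_exp_opp : ex_series (fun n => exp (- INR n)).
Proof.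
apply ex_series_ext with (fun n => exp (-1) ^ n).
- intros n; induction n as [|n IH].
  + simpl; rewrite Ropp_0, exp_0; reflexivity.
  + rewrite S_INR; simpl; rewrite IH, <- exp_plus; f_equal; ring.
- apply ex_series_geom; rewrite Rabs_pos_eq by (left; apply exp_pos).
  rewrite <- exp_0; apply exp_increasing; lra.
Qed.

Lemma ex_series_eventually_le (u : nat -> R) (N K : R) :
  (forall n, N <= INR n -> Rabs (u n) <= K * exp (- INR n)) -> ex_series u.
Proof.
intros Hu.
(* The first n0 + 1 terms are dropped; every remaining index is at least n0 + 1 > |N|, hence in the
   range of the bound. *)
destruct (nfloor_ex (Rabs N)) as [n0 [_ Hn0]]; [apply Rabs_pos|].
apply ex_series_incr_n with (n := S n0).
apply (@ex_series_le R_AbsRing R_CompleteNormedModule _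
         (fun k => K * exp (- INR (S n0 + k)))).
- intros k; apply Hu; rewrite plus_INR, S_INR.
  pose proof (pos_INR k); pose proof (Rle_abs N); lra.
- apply (ex_series_incr_n (fun k => K * exp (- INR k)) (S n0)).
  apply (@ex_series_scal R_AbsRing R_NormedModule K), ex_series_exp_opp.
Qed.

Lemma Rabs_Re_le (z : C) : Rabs (Re z) <= Cmod z.
Proof. eapply Rle_trans; [apply Rmax_l | apply Rmax_Cmod]. Qed.

Lemma Rabs_Im_le (z : C) : Rabs (Im z) <= Cmod z.
Proof. eapply Rle_trans; [apply Rmax_r | apply Rmax_Cmod]. Qed.

(** [Zsum] consists of four real series; an abstract [p] treats real and imaginary parts at once. *)
Lemma exp_decay_ex_series (a : Z -> C) (p : C -> R) :
  (forall z, Rabs (p z) <= Cmod z) -> exp_decay a ->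
  ex_series (fun n => p (a (Z.of_nat n))) /\
  ex_series (fun n => p (a (- Z.of_nat (S n))%Z)).
Proof.
intros Hp (N & K & Ha); split.
- apply ex_series_eventually_le with N K; intros n Hn.
  assert (E : Rabs (IZR (Z.of_nat n)) = INR n).
  { rewrite <- INR_IZR_INZ; apply Rabs_pos_eq, pos_INR. }
  rewrite <- E in *; eapply Rle_trans; [apply Hp | apply Ha, Hn].
(* The negative half starts at j = -1; adding the term j = 0 makes |j| equal to the summation
   index. *)
- apply (ex_series_incr_n (fun n => p (a (- Z.of_nat n)%Z)) 1).
  apply ex_series_eventually_le with N K; intros n Hn.
  assert (E : Rabs (IZR (- Z.of_nat n)) = INR n).
  { rewrite opp_IZR, Rabs_Ropp, <- INR_IZR_INZ; apply Rabs_pos_eq, pos_INR. }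
  rewrite <- E in *; eapply Rle_trans; [apply Hp | apply Ha, Hn].
Qed.

Lemma Zsum_ext (a b : Z -> C) : (forall j, a j = b j) -> Zsum a = Zsum b.
Proof.
intros E; unfold Zsum, CSeries.
f_equal; apply C_eq; simpl; apply Series_ext; intros n; rewrite E; reflexivity.
Qed.

Lemma CSeries_minus (a b : nat -> C) :
  ex_series (fun n => Re (a n)) -> ex_series (fun n => Im (a n)) ->
  ex_series (fun n => Re (b n)) -> ex_series (fun n => Im (b n)) ->
  CSeries (fun n => (a n - b n)%C) = (CSeries a - CSeries b)%C.
Proof.
intros; unfold CSeries; apply C_eq; simpl.
- rewrite (Series_ext _ (fun n => Re (a n) - Re (b n))) by reflexivity.
  rewrite Series_minus by assumption; ring.
- rewrite (Series_ext _ (fun n => Im (a n) - Im (b n))) by reflexivity.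
  rewrite Series_minus by assumption; ring.
Qed.

Lemma Zsum_minus (a b : Z -> C) : exp_decay a -> exp_decay b ->
  Zsum (fun j => (a j - b j)%C) = (Zsum a - Zsum b)%C.
Proof.
intros Ha Hb.
destruct (exp_decay_ex_series a Re Rabs_Re_le Ha).
destruct (exp_decay_ex_series a Im Rabs_Im_le Ha).
destruct (exp_decay_ex_series b Re Rabs_Re_le Hb).
destruct (exp_decay_ex_series b Im Rabs_Im_le Hb).
unfold Zsum; rewrite !CSeries_minus by assumption; ring.
Qed.

(** * Decay of the summands of [PhiA11] *)

Lemma exp_le_compat (x y : R) : x <= y -> exp x <= exp y.
Proof. intros [H | ->]; [left; apply exp_increasing, H | right; reflexivity]. Qed.

(** Since e >= 2, the modulus of x is either at least 2 or at most 1/2, and the triangle inequality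
    keeps x away from 1 in both cases. *)
Lemma half_le_Cmod_1_minus (x : C) (r : R) :
  Cmod x = exp r -> 1 <= Rabs r -> / 2 <= Cmod (1 - x).
Proof.
intros Hx Hr.
pose proof (exp_ineq1_le 1) as He.
assert (T1 : Cmod x <= 1 + Cmod (1 - x)).
{ rewrite <- Cmod_1 at 1; rewrite <- (Cmod_opp (1 - x)).
  replace x with (1 + - (1 - x))%C at 1 by ring; apply Cmod_triangle. }
assert (T2 : 1 <= Cmod x + Cmod (1 - x)).
{ rewrite <- Cmod_1 at 1.
  replace (RtoC 1) with (x + (1 - x))%C at 1 by ring; apply Cmod_triangle. }
destruct (Rle_lt_dec 0 r) as [H0|H0].
- rewrite Rabs_pos_eq in Hr by assumption.
  assert (exp 1 <= exp r) by (apply exp_le_compat; assumption); lra.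
- rewrite Rabs_left in Hr by assumption.
  assert (H1 : exp r <= exp (- (1))) by (apply exp_le_compat; lra).
  rewrite exp_Ropp in H1.
  assert (/ exp 1 <= / 2) by (apply Rinv_le_contravar; lra); lra.
Qed.

(** Beyond the threshold c x^2 >= (|a| + 1) |x|, which absorbs a x and still leaves -|x|. *)
Lemma exp_quadratic_le (a b c x : R) : 0 < c -> (Rabs a + 1) / c <= Rabs x ->
  exp (a * x + b - c * x ^ 2) <= exp b * exp (- Rabs x).
Proof.
intros Hc Hx; rewrite <- exp_plus; apply exp_le_compat.
apply (Rmult_le_compat_l c) in Hx; [|lra].
replace (c * ((Rabs a + 1) / c)) with (Rabs a + 1) in Hx by (field; lra).
pose proof (Rle_abs (a * x)) as H1; rewrite Rabs_mult in H1.
pose proof (Rabs_pos x).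
assert (x ^ 2 = Rabs x * Rabs x) as -> by (rewrite <- Rabs_mult, Rabs_pos_eq; nra).
nra.
Qed.

(** Both fractions in the summand of [PhiA11] have this shape, with v = z1 or v = -z2. The Gaussian
    factor q^(m n^2) dominates the numerator, and the denominator stays away from 0 for large
    |n|. *)
Lemma exp_decay_term (m s : R) (tau u w v : C) : 0 < m -> 0 < Im tau ->
  exp_decay (fun n =>
    e2pi (IZR n * u + w) * e2pi ((m * IZR n ^ 2 + s * IZR n)%R * tau)
      / ((1 - e2pi v * e2pi (IZR n * tau)) * (1 - e2pi v * e2pi (IZR n * tau))))%C.
Proof.
intros Hm Ht.
pose proof PI_RGT_0 as HPI.
set (y := Im tau) in *.
(* With x = n, the numerator has modulus exp(a x + b - c x^2), and e(v) q^x has modulus exp(p - r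
   x). *)
set (c := 2 * PI * (m * y)).
set (a := - (2 * PI * (Im u + s * y))).
set (b := - (2 * PI * Im w)).
set (p := - (2 * PI * Im v)).
set (r := 2 * PI * y).
assert (Hc : 0 < c) by (unfold c; repeat (lra || apply Rmult_lt_0_compat)).
assert (Hr : 0 < r) by (unfold r; repeat (lra || apply Rmult_lt_0_compat)).
(* The first threshold serves [exp_quadratic_le]; the second gives |p - r x| >= r |x| - |p| >= 1, so
   that each factor of the denominator has modulus at least 1/2, whence the constant 4. *)
exists (Rmax ((Rabs a + 1) / c) ((Rabs p + 1) / r)), (4 * exp b).
intros n Hn; set (x := IZR n) in *.
assert (Hx1 : (Rabs a + 1) / c <= Rabs x)
  by (eapply Rle_trans; [apply Rmax_l | exact Hn]).
assert (Hx2 : (Rabs p + 1) / r <= Rabs x)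
  by (eapply Rle_trans; [apply Rmax_r | exact Hn]).
assert (HD : / 2 <= Cmod (1 - e2pi v * e2pi (x * tau))).
{ apply half_le_Cmod_1_minus with (p - r * x).
  - rewrite <- e2pi_plus, Cmod_e2pi; f_equal.
    unfold p, r, y, Im; simpl; ring.
  - apply (Rmult_le_compat_l r) in Hx2; [|lra].
    replace (r * ((Rabs p + 1) / r)) with (Rabs p + 1) in Hx2 by (field; lra).
    pose proof (Rabs_triang_inv (r * x) p) as H1.
    rewrite Rabs_mult, (Rabs_pos_eq r), Rabs_minus_sym in H1 by lra; lra. }
set (D := (1 - e2pi v * e2pi (x * tau))%C) in *.
assert (HD0 : D <> 0).
{ intros E; rewrite E, Cmod_0 in HD; lra. }
rewrite <- e2pi_plus; unfold Cdiv.
rewrite Cmod_mult, Cmod_inv, Cmod_mult, Cmod_e2pi by (apply Cmult_neq_0; assumption).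
replace (- (2 * PI * Im _)) with (a * x + b - c * x ^ 2)
  by (unfold a, b, c, y, Im; simpl; ring).
assert (Hi : / (Cmod D * Cmod D) <= 4).
{ replace 4 with (/ (/ 2 * / 2)) by field.
  apply Rinv_le_contravar; [lra | apply Rmult_le_compat; lra]. }
pose proof (exp_quadratic_le a b c x Hc Hx1).
assert (0 < / (Cmod D * Cmod D)) by (apply Rinv_0_lt_compat; nra).
pose proof (exp_pos (a * x + b - c * x ^ 2)).
nra.
Qed.

Lemma exp_decay_ext (a b : Z -> C) :
  (forall j, a j = b j) -> exp_decay a -> exp_decay b.
Proof.
intros E (N & K & Ha); exists N, K; intros j; rewrite <- E; apply Ha.
Qed.

Lemma exp_decay_PhiA11 (m s : R) (tau z1 z2 : C) : 0 < m -> 0 < Im tau ->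
  exp_decay (fun n =>
    let j := IZR n in
    e2pi (m * j * (z1 + z2) + s * z1) * e2pi ((m * j ^ 2 + s * j)%R * tau)
      / ((1 - e2pi z1 * e2pi (j * tau)) * (1 - e2pi z1 * e2pi (j * tau)))
    - e2pi (- (m * j * (z1 + z2)) - s * z2) * e2pi ((m * j ^ 2 + s * j)%R * tau)
      / ((1 - e2pi (- z2) * e2pi (j * tau)) * (1 - e2pi (- z2) * e2pi (j * tau))))%C.
Proof.
intros Hm Ht; apply exp_decay_minus.
- eapply exp_decay_ext;
    [|apply (exp_decay_term m s tau (m * (z1 + z2)) (s * z1) z1 Hm Ht)].
  intros n; simpl.
  replace (IZR n * (m * (z1 + z2)) + s * z1)%C
    with (m * IZR n * (z1 + z2) + s * z1)%C by ring; reflexivity.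
- eapply exp_decay_ext;
    [|apply (exp_decay_term m s tau (- (m * (z1 + z2))) (- (s * z2)) (- z2) Hm Ht)].
  intros n; simpl.
  replace (IZR n * - (m * (z1 + z2)) + - (s * z2))%C
    with (- (m * IZR n * (z1 + z2)) - s * z2)%C by ring; reflexivity.
Qed.

(** * The difference identity between [PhiA11] and [Phi] *)

(** Also valid at the pole [x = 1], where [/ 0 = 0] makes both sides [0]. *)
Lemma Cdiv_square_minus (a x : C) :
  (a / ((1 - x) * (1 - x)) - a * x / ((1 - x) * (1 - x)) = a / (1 - x))%C.
Proof.
destruct (Ceq_dec (1 - x) 0) as [E|E].
- assert (I0 : (/ RtoC 0 = 0)%C).
  { unfold Cinv; apply C_eq; simpl; unfold Rdiv; ring. }
  rewrite E, Cmult_0_l; unfold Cdiv; rewrite I0; ring.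
- field; exact E.
Qed.

Lemma PhiA11_minus (m s : R) (tau z1 z2 t : C) : 0 < m -> 0 < Im tau ->
  (PhiA11 m s tau z1 z2 t - PhiA11 m (s + 1)%R tau z1 z2 t = Phi m s tau z1 z2 t)%C.
Proof.
intros Hm Ht; unfold PhiA11, Phi.
match goal with |- (?e * Zsum ?a - ?e * Zsum ?b)%C = _ =>
  replace (e * Zsum a - e * Zsum b)%C with (e * (Zsum a - Zsum b))%C by ring end.
f_equal.
rewrite <- Zsum_minus by (apply exp_decay_PhiA11; assumption).
apply Zsum_ext; intros n; cbv zeta; set (j := IZR n).
set (x1 := (e2pi z1 * e2pi (j * tau))%C).
set (x2 := (e2pi (- z2) * e2pi (j * tau))%C).
set (a1 := (e2pi (m * j * (z1 + z2) + s * z1) * e2pi ((m * j ^ 2 + s * j)%R * tau))%C).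
set (a2 := (e2pi (- (m * j * (z1 + z2)) - s * z2) * e2pi ((m * j ^ 2 + s * j)%R * tau))%C).
match goal with |- (_ - (?b1 / _ - ?b2 / _))%C = _ =>
  replace b1 with (a1 * x1)%C; [replace b2 with (a2 * x2)%C|] end.
- rewrite <- (Cdiv_square_minus a1), <- (Cdiv_square_minus a2); ring.
- unfold a2, x2; rewrite <- !e2pi_plus; f_equal.
  rewrite !RtoC_plus, !RtoC_mult, RtoC_plus; ring.
- unfold a1, x1; rewrite <- !e2pi_plus; f_equal.
  rewrite !RtoC_plus, !RtoC_mult, RtoC_plus; ring.
Qed.

(** * Periodicity of [Phi] and its comparison with [Psi] *)

(** In the n-th term the three exponents containing z2 change by the integers m n, -m n - s and
    -1. *)
Lemma Phi_add_1 (m s : Z) (tau z1 z2 t : C) :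
  Phi (IZR m) (IZR s) tau z1 (z2 + 1) t = Phi (IZR m) (IZR s) tau z1 z2 t.
Proof.
unfold Phi; f_equal; apply Zsum_ext; intros n; cbv zeta.
rewrite (e2pi_add_IZR (IZR m * IZR n * (z1 + z2) + IZR s * z1)
          (IZR m * IZR n * (z1 + (z2 + 1)) + IZR s * z1) (m * n))
  by (rewrite mult_IZR, RtoC_mult; ring).
rewrite (e2pi_add_IZR (- (IZR m * IZR n * (z1 + z2)) - IZR s * z2)
          (- (IZR m * IZR n * (z1 + (z2 + 1))) - IZR s * (z2 + 1)) (- (m * n) - s))
  by (rewrite minus_IZR, opp_IZR, mult_IZR, RtoC_minus, RtoC_opp, RtoC_mult; ring).
rewrite (e2pi_add_IZR (- z2) (- (z2 + 1)) (-1))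
  by (apply C_eq; simpl; ring).
reflexivity.
Qed.

(** The exponential prefactor of [Psi] at t = 0 becomes the factor e(-m T) of [Phi]. What remains is
    three identities between arguments, left as hypotheses to be checked coordinatewise. *)
Lemma Psi_eq_Phi (M m s eps j k eps' : R) (tau z1 z2 w1 w2 T : C) :
  w1 = (z1 + j * tau + eps)%C -> w2 = (z2 + k * tau - eps)%C ->
  (- (m * T))%C = ((m / M * j * k)%R * tau + (m / M)%R * (k * z1 + j * z2))%C ->
  Psi M m s eps j k eps' tau z1 z2 0 = Phi m s (M * tau) w1 w2 T.
Proof.
intros -> -> HT; unfold Psi, Phi; rewrite HT.
replace (- (m * (0 / M)))%C with (RtoC 0)
  by (unfold Cdiv; ring).
rewrite e2pi_0, Cmult_1_l, <- e2pi_plus; reflexivity.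
Qed.

(** * Numerators of the modules [ddotH] *)

Lemma ch_dsum_parity_rev (e : sgn) (V W : N4module) (tau z : C) :
  ch e (dsum V (parity_rev W)) tau z =
  match e with
  | Plus => ch Plus V tau z + ch Plus W tau z
  | Minus => ch Minus V tau z - ch Minus W tau z
  end%C.
Proof. destruct e; simpl; ring. Qed.

(** For both signs the two summands combine to a difference of [PhiA11] at s = m2 + 1 and s = m2 +
    2: for [Plus] because [sigma] changes sign with m2, for [Minus] because parity reversal negates
    the supercharacter. *)
Lemma numerator_ddotH
    (numL : sgn -> pa_weight -> C -> C -> C -> C -> C)
    (R4 : sgn -> C -> C -> C) (H : pa_weight -> N4module) (dom : C -> C -> Prop)
    (HnumL : numerators_L numL) (HnumH : numerators_H numL R4 H dom)
    (e : sgn) (M m m2 : Z) (h : heart) (k1 k2 : Z) (tau z : C) :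
  admissible M m m2 h k1 k2 -> admissible M m (m2 + 1) h k1 k2 ->
  0 < Im tau -> dom tau z ->
  (R4 e tau z * ch e (ddotH H M m m2 h k1 k2) tau z =
   Defs.sigma e m2 * Phi (IZR m) (IZR (m2 + 1)) (IZR M * tau)
     (zeta1 h (IZR k1) (IZR k2) tau (z + tau / 2) (z - tau / 2) + ashift e)
     (zeta2 h (IZR k1) (IZR k2) tau (z + tau / 2) (z - tau / 2) + ashift e)
     (MT h (IZR k1) (IZR k2) tau (z + tau / 2) (z - tau / 2) (tau / 4) / IZR M))%C.
Proof.
intros A1 A2 Ht Hd.
assert (Hm : 0 < IZR m) by (apply IZR_lt, A1).
assert (HM : 0 < Im (IZR M * tau)%C).
{ replace (Im (IZR M * tau)%C) with (IZR M * Im tau) by (unfold Im; simpl; ring).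
  apply Rmult_lt_0_compat; [apply IZR_lt, A1 | exact Ht]. }
rewrite <- PhiA11_minus by assumption.
unfold ddotH; rewrite ch_dsum_parity_rev.
pose proof (HnumH e M m m2 h k1 k2 tau z A1 Ht Hd) as E1.
pose proof (HnumH e M m (m2 + 1)%Z h k1 k2 tau z A2 Ht Hd) as E2.
rewrite HnumL in E1, E2 by assumption.
rewrite <- !plus_IZR in E1; rewrite <- plus_IZR in E2; rewrite <- plus_IZR.
destruct e; unfold Defs.sigma in *.
- rewrite Cmult_plus_distr_l, E1, E2, (powerRZ_add (-1) (m2 + 1)) by lra.
  rewrite powerRZ_1, RtoC_mult.
  replace (RtoC (-1)) with (- (1))%C by (apply C_eq; simpl; ring).
  ring.
- transitivity (R4 Minus tau z * ch Minus (H (Lambda M m m2 h k1 k2)) tau z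
    - R4 Minus tau z * ch Minus (H (Lambda M m (m2 + 1) h k1 k2)) tau z)%C.
  + ring.
  + rewrite E1, E2; ring.
Qed.

Theorem lemma7p1
    (numL : sgn -> pa_weight -> C -> C -> C -> C -> C)
    (R4 : sgn -> C -> C -> C)
    (H : pa_weight -> N4module)
    (dom : C -> C -> Prop)
    (HnumL : numerators_L numL)
    (HnumH : numerators_H numL R4 H dom)
    (M m m2 : Z) (hM : (0 < M)%Z) (hm : (0 < m)%Z) (hcop : Z.gcd M m = 1%Z)
    (hm2 : (0 <= m2 <= m - 1)%Z)
    (h : heart) (k1 k2 : Z) (hk : k_range h M k1 k2)
    (tau z : C) (htau : 0 < Im tau) (hdom : dom tau z) :
  (R4 Plus tau z * ch Plus (ddotH H M m m2 h k1 k2) tau z)%C =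
    match h with
    | heartI =>
        (powerRZ (-1) (m2 + 1) *
         Psi (IZR M) (IZR m) (IZR m2 + 1)%R (1 / 2)%R
           (IZR k1 + 1 / 2)%R (- (IZR k1 + IZR k2 + 1 / 2))%R (1 / 2)%R
           tau z z 0%R)%C
    | heartII =>
        (powerRZ (-1) (m2 + 1) *
         Psi (IZR M) (IZR m) (IZR m2 + 1)%R (1 / 2)%R
           (IZR k1 - 1 / 2)%R (- (IZR k1 + IZR k2 - 1 / 2))%R (1 / 2)%R
           tau (- z) (- z) 0%R)%C
    | heartIII =>
        (powerRZ (-1) (m2 + 1) *
         Psi (IZR M) (IZR m) (IZR m2 + 1)%R (1 / 2)%R
           (IZR k1 + 1 / 2)%R (- (IZR k1 + IZR k2 + 1 / 2))%R (1 / 2)%R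
           tau (- z) (- z) 0%R)%C
    | heartIV =>
        (powerRZ (-1) (m2 + 1) *
         Psi (IZR M) (IZR m) (IZR m2 + 1)%R (1 / 2)%R
           (IZR k1 - 1 / 2)%R (- (IZR k1 + IZR k2 - 1 / 2))%R (1 / 2)%R
           tau z z 0%R)%C
    end
  /\
  (R4 Minus tau z * ch Minus (ddotH H M m m2 h k1 k2) tau z)%C =
    match h with
    | heartI =>
        (Psi (IZR M) (IZR m) (IZR m2 + 1)%R 0%R
           (IZR k1 + 1 / 2)%R (- (IZR k1 + IZR k2 + 1 / 2))%R (1 / 2)%R
           tau z z 0%R)%C
    | heartII =>
        (Psi (IZR M) (IZR m) (IZR m2 + 1)%R 0%R
           (IZR k1 - 1 / 2)%R (- (IZR k1 + IZR k2 - 1 / 2))%R (1 / 2)%R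
           tau (- z) (- z) 0%R)%C
    | heartIII =>
        (Psi (IZR M) (IZR m) (IZR m2 + 1)%R 0%R
           (IZR k1 + 1 / 2)%R (- (IZR k1 + IZR k2 + 1 / 2))%R (1 / 2)%R
           tau (- z) (- z) 0%R)%C
    | heartIV =>
        (Psi (IZR M) (IZR m) (IZR m2 + 1)%R 0%R
           (IZR k1 - 1 / 2)%R (- (IZR k1 + IZR k2 - 1 / 2))%R (1 / 2)%R
           tau z z 0%R)%C
    end.
Proof.
assert (A1 : admissible M m m2 h k1 k2) by (repeat split; lia || assumption).
(* Here m2 <= m - 1 is what keeps m2 + 1 in the admissible range. *)
assert (A2 : admissible M m (m2 + 1) h k1 k2) by (repeat split; lia || assumption).
assert (HM : IZR M <> 0) by (apply not_0_IZR; lia).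
pose proof (fun e => numerator_ddotH numL R4 H dom HnumL HnumH e M m m2 h k1 k2
                       tau z A1 A2 htau hdom) as E.
rewrite !E, <- !(plus_IZR m2 1); unfold Defs.sigma, ashift; split.
- set (w := zeta2 _ _ _ _ _ _).
  replace (w + (1 / 2)%R)%C with (w - (1 / 2)%R + 1)%C
    by (apply C_eq; simpl; field).
  rewrite Phi_add_1; unfold w.
  (* In each type the shifts z + tau/2, z - tau/2 replace k1 and k1 + k2 by k1 ± 1/2 and k1 + k2 ±
     1/2 with a common sign, and t = tau/4 completes k1 (k1 + k2) tau to the product (k1 ± 1/2)(k1 +
     k2 ± 1/2) tau, which is -j k tau. *)
  destruct h; f_equal; symmetry; apply Psi_eq_Phi;
    destruct tau, z; apply C_eq; simpl; field; assumption.
- destruct h; rewrite Cmult_1_l; symmetry; apply Psi_eq_Phi;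
    destruct tau, z; apply C_eq; simpl; field; assumption.
Qed.
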